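(* For any $k\in\mathbb{N}$ and any graph $H\in\mathcal{IIM}_k(K_1)$, $$\omega(H)\ge 2+\left\lceil\frac{2(k-5)}{3}\right\rceil.$$
   Context: Graphs are finite, simple and undirected. $N(v)$ is the neighborhood of $v$ and $N[v]=\{v\}\cup N(v)$. $K_1$ is the one-vertex graph and $\omega(H)$ is the clique number of $H$. The Iterated Independent Model (IIM): Given a graph $G'$, one time step adds to $G'$, for every vertex $v \in V(G')$, exactly one new vertex $v'$ (the copy of $v$), which is, by a choice made independently for each $v$, either a clone of $v$, meaning $N(v')=N[v]$, or an anticlone of $v$, meaning $N(v')=V(G')\setminus N[v]$; here $N[v]$ is taken in $G'$, no edges are added among old vertices, and the vertices added in the same step are pairwise non-adjacent. $\mathcal{IIM}_k(G)$ is the set of all graphs obtainable from $G$ by $k$ successive time steps (over all choices), with $\mathcal{IIM}_0(G)=\{G\}$. *)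

(* Defs.v *)
From mathcomp Require Import all_boot all_order all_algebra.

Set Implicit Arguments.
Unset Strict Implicit.
Unset Printing Implicit Defensive.

Record sgraph := SGraph {
  vertex :> finType;
  adj : rel vertex;
  adj_sym : symmetric adj;
  adj_irr : irreflexive adj
}.

Definition nbhd (G : sgraph) (v : G) : {set G} := [set u | adj v u].

Definition cnbhd (G : sgraph) (v : G) : {set G} := v |: nbhd v.

Definition clique (G : sgraph) (A : {set G}) : bool :=
  [forall u in A, forall v in A, (u != v) ==> adj u v].

Definition clique_number (G : sgraph) : nat :=
  \max_(A : {set G} | clique A) #|A|.

Definition giso (G H : sgraph) : Prop :=
  exists2 f : G -> H, bijective f & forall u v : G, adj (f u) (f v) = adj u v.

Lemma K1_sym : symmetric (fun _ _ : unit => false).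
Proof. by []. Qed.

Lemma K1_irr : irreflexive (fun _ _ : unit => false).
Proof. by []. Qed.

Definition K1 : sgraph := SGraph K1_sym K1_irr.

Section Step.

Variables (G : sgraph) (c : G -> bool).

(* [c v] holds when the copy of [v] is a clone, and fails when it is an
   anticlone. *)
Definition copy_nbhd (v : G) : {set G} :=
  if c v then cnbhd v else ~: cnbhd v.

(* [inl v] is the old vertex [v], and [inr v] is its copy. *)
Definition step_adj (x y : G + G) : bool :=
  match x, y with
  | inl u, inl v => adj u v
  | inl u, inr v => u \in copy_nbhd v
  | inr u, inl v => v \in copy_nbhd u
  | inr _, inr _ => false
  end.

Lemma step_adj_sym : symmetric step_adj.
Proof. by case=> [u|u] [v|v] //=; exact: adj_sym. Qed.

Lemma step_adj_irr : irreflexive step_adj.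
Proof. by case=> [u|u] //=; exact: adj_irr. Qed.

Definition step : sgraph := SGraph step_adj_sym step_adj_irr.

End Step.

(* [IIM G k H] means that [H] belongs to IIM_k(G). Graphs are considered up to
   isomorphism, so that vertices may carry arbitrary names. *)
Inductive IIM (G : sgraph) : nat -> sgraph -> Prop :=
| IIM_init (H : sgraph) : giso G H -> IIM G 0 H
| IIM_step (k : nat) (G' : sgraph) (c : G' -> bool) (H : sgraph) :
    IIM G k G' -> giso (step c) H -> IIM G k.+1 H.

(* Main.v *)
Require Import Defs.
From mathcomp Require Import all_boot all_order all_algebra.
From mathcomp Require Import zify lra.
Import Order.TTheory GRing.Theory Num.Theory.
Local Open Scope ring_scope.

Set Implicit Arguments.
Unset Strict Implicit.
Unset Printing Implicit Defensive.

(** Call two disjoint cliques [P], [Q] with no edge between them separated. In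
    one step [P] can be enlarged by the copy of a cloned vertex of [P] or of an
    anticloned vertex of [Q], and symmetrically for [Q]; both enlargements can
    be made at once, since the two new vertices are not adjacent. Hence
    [#|P| + #|Q|] grows by 2, except that it grows by 1 when one of the two
    cliques is entirely cloned and the other entirely anticloned. If three
    separated pairs are linked by [P1] meeting [P2], [P2] meeting [P3] and [P3]
    meeting [Q1], the exceptional case cannot occur for all three, so the six
    sizes together grow by at least 4. Every graph of IIM_3(K_1) has such pairs
    of total size 8, whence 6 omega >= 8 + 4 (k - 3) for k >= 3. *)

(** * Closed adjacency and linked pairs of separated cliques *)

Section ClosedAdjacency.

Variable G : sgraph.
Implicit Types (u v : G) (P Q : {set G}).

Definition cadj u v := (u == v) || adj u v.

Lemma cadj_sym : symmetric cadj.
Proof. by move=> u v; rewrite /cadj eq_sym adj_sym. Qed.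

Lemma cadj_refl : reflexive cadj.
Proof. by move=> u; rewrite /cadj eqxx. Qed.

(** Since [cadj] is reflexive, the last clause also makes [P] and [Q] disjoint. *)
Definition separated P Q :=
  [/\ {in P &, forall u v, cadj u v}, {in Q &, forall u v, cadj u v}
    & {in P & Q, forall u v, ~~ cadj u v}].

Lemma separated_sym P Q : separated P Q -> separated Q P.
Proof. by case=> cP cQ sPQ; split=> // u v uQ vP; rewrite cadj_sym sPQ. Qed.

Lemma leq_clique_number P :
  {in P &, forall u v, cadj u v} -> (#|P| <= clique_number G)%N.
Proof.
move=> cP; suff: clique P by exact: (@leq_bigmax_cond _ (@clique G) (fun A => #|A|)).
apply/forall_inP=> u uP; apply/forall_inP=> v vP; apply/implyP=> nuv.
by have := cP u v uP vP; rewrite /cadj (negPf nuv).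
Qed.

Definition linked_pairs n := exists P1 Q1 P2 Q2 P3 Q3 : {set G},
  [/\ separated P1 Q1, separated P2 Q2, separated P3 Q3
    & exists a b d y z,
      [/\ (a \in P1 :&: P2) && (b \in P2 :&: P3), d \in P3 :&: Q1,
          (y \in Q2) && (z \in Q3)
        & (n <= #|P1| + #|Q1| + (#|P2| + #|Q2|) + (#|P3| + #|Q3|))%N]].

Lemma linked_pairs_clique_number n :
  linked_pairs n -> (n <= 6 * clique_number G)%N.
Proof.
move=> [P1 [Q1 [P2 [Q2 [P3 [Q3 [[p1 q1 _] [p2 q2 _] [p3 q3 _]]]]]]]].
move=> [a [b [d [y [z [_ _ _]]]]]].
move: (leq_clique_number p1) (leq_clique_number q1) (leq_clique_number p2).
move: (leq_clique_number q2) (leq_clique_number p3) (leq_clique_number q3).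
lia.
Qed.

End ClosedAdjacency.

(** * Transport along isomorphisms *)

Section Isomorphism.

Variables (G H : sgraph) (f : G -> H).
Hypotheses (f_inj : injective f) (f_adj : forall u v, adj (f u) (f v) = adj u v).

Lemma cadj_inj u v : cadj (f u) (f v) = cadj u v.
Proof. by rewrite /cadj f_adj inj_eq. Qed.

Lemma separated_imset (P Q : {set G}) :
  separated P Q -> separated (f @: P) (f @: Q).
Proof.
case=> cP cQ sPQ.
by split=> _ _ /imsetP[u uP ->] /imsetP[v vP ->]; rewrite cadj_inj; auto.
Qed.

Lemma linked_pairs_imset n : linked_pairs G n -> linked_pairs H n.
Proof.
move=> [P1 [Q1 [P2 [Q2 [P3 [Q3 [s1 s2 s3]]]]]]].
move=> [a [b [d [y [z [ab hd yz le_n]]]]]].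
exists (f @: P1), (f @: Q1), (f @: P2), (f @: Q2), (f @: P3), (f @: Q3).
split; try exact: separated_imset.
exists (f a), (f b), (f d), (f y), (f z).
by rewrite !inE !(mem_imset _ _ f_inj) !card_imset //; split=> //;
  rewrite -?in_setI.
Qed.

End Isomorphism.

(** * Growth of separated pairs in one time step *)

Section Step.

Variables (G : sgraph) (c : G -> bool).

(** A clone reproduces the closed adjacency of its original to old vertices and an anticlone negates
    it, so one Boolean equation covers both kinds. *)
Lemma cadj_step (x y : step c) :
  cadj x y = match x, y with
             | inl u, inl v => cadj u v
             | inl u, inr v | inr v, inl u => c v == cadj v u
             | inr u, inr v => u == v
             end.
Proof.
have copyE u v : (u \in copy_nbhd c v) = (c v == cadj v u).
  rewrite /copy_nbhd /cadj [v == u]eq_sym.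
  by case: (c v); rewrite !inE; case: (_ || _).
by case: x y => [u|u] [v|v]; rewrite /cadj /= ?copyE ?orbF.
Qed.

Definition extends (P Q : {set G}) u := (u \in P) && c u || (u \in Q) && ~~ c u.

(** Copies are pairwise non-adjacent, so a clique can gain only one of them; [pick] selects it. *)
Definition extension (P Q : {set G}) : {set step c} :=
  [set x | match x with
           | inl u => u \in P
           | inr u => [pick v | extends P Q v] == Some u
           end].

Lemma extensionP (P Q : {set G}) (x : step c) :
  x \in extension P Q ->
  match x with inl u => u \in P | inr u => extends P Q u end.
Proof.
by rewrite inE; case: x => [//|u]; case: pickP => // v ? /eqP[<-].
Qed.

Lemma card_extension (P Q : {set G}) :
  #|extension P Q| = (#|P| + [exists u, extends P Q u])%N.
Proof.
have -> : extension P Q =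
    inl @: P :|: inr @: [set u | [pick v | extends P Q v] == Some u].
  apply/setP=> -[u|u]; rewrite !inE.
    rewrite (mem_imset _ _ inl_inj) orbC; case: imsetP => // -[] //.
  rewrite (mem_imset _ _ inr_inj) inE; case: imsetP => // -[] //.
rewrite cardsU !card_imset; [|exact: inr_inj|exact: inl_inj].
rewrite [X in (_ - X)%N](_ : _ = 0)%N ?subn0; last first.
  apply/eqP; rewrite cards_eq0; apply/eqP/setP=> x; rewrite !inE.
  by apply/negP=> /andP[/imsetP[u _ ->] /imsetP[v _]].
congr addn; case: pickP => [v ev | none].
  rewrite (_ : [exists _, _] = true); last by apply/existsP; exists v.
  by rewrite -[RHS](cards1 v); apply: eq_card => u; rewrite !inE eq_sym.
rewrite (_ : [exists _, _] = false); last by apply/existsP=> -[v]; rewrite none.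
by apply/eqP; rewrite cards_eq0; apply/eqP/setP=> u; rewrite !inE.
Qed.

Lemma separated_extension (P Q : {set G}) :
  separated P Q -> separated (extension P Q) (extension Q P).
Proof.
have clique_ext P' Q' : separated P' Q' ->
    {in extension P' Q' &, forall x y, cadj x y}.
  move=> [cP cQ sPQ].
  (* A clone of [v] in [P'] sees all of the clique [P']; an anticlone of [v] in [Q'] sees all of it
     because [v] sees none. *)
  have old_new u v : u \in P' -> extends P' Q' v -> c v == cadj v u.
    move=> uP /orP[] /andP[vP cv]; first by rewrite cv cP.
    by rewrite (negPf cv) cadj_sym (negPf (sPQ _ _ uP vP)).
  move=> x y xP yP; rewrite cadj_step.
  move: (extensionP xP) (extensionP yP).
  case: x y xP yP => [u|u] [v|v] xP yP hx hy; auto.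
  by move: xP yP; rewrite !inE => /eqP-> /eqP[->].
move=> sPQ; split; [exact: clique_ext|exact/clique_ext/separated_sym|].
case: sPQ => cP cQ sPQ.
have nPQ u : u \in P -> u \in Q -> False.
  by move=> uP uQ; have := sPQ u u uP uQ; rewrite cadj_refl.
move=> x y /extensionP xP /extensionP yP; rewrite cadj_step.
case: x y xP yP => [u|u] [v|v].
- exact: sPQ.
- move=> uP /orP[] /andP[vQ cv]; last by rewrite (negPf cv) cP.
  by rewrite cv cadj_sym (negPf (sPQ _ _ uP vQ)).
- move=> /orP[] /andP[uP cu] vQ; last by rewrite (negPf cu) cQ.
  by rewrite cu (negPf (sPQ _ _ uP vQ)).
(* A vertex whose copy extended both cliques would lie in both [P] and [Q]. *)
move=> eu ev; apply/eqP=> uv; move: eu ev; rewrite -{v}uv /extends.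
have := nPQ u; case: (u \in P) (u \in Q) (c u) => [] [] [] // h _ _.
all: by have := h isT isT.
Qed.

Lemma extends_ge1 (P Q : {set G}) u :
  extends P Q u -> [exists v, extends P Q v] = true.
Proof. by move=> ?; apply/existsP; exists u. Qed.

(** Every pair gains at least 1. If [c a], [c b] and [c d] agree, the first pair gains 2, since [a]
    and [d] lie on its opposite sides. Otherwise [c] differs on [a] and [b], which share [P2], or on
    [b] and [d], which share [P3], and that pair gains 2. *)
Lemma linked_pairs_step n : linked_pairs G n -> linked_pairs (step c) (n + 4).
Proof.
move=> [P1 [Q1 [P2 [Q2 [P3 [Q3 [s1 s2 s3]]]]]]].
move=> [a [b [d [y [z [ab hd yz le_n]]]]]].
exists (extension P1 Q1), (extension Q1 P1), (extension P2 Q2),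
  (extension Q2 P2), (extension P3 Q3), (extension Q3 P3).
split; try exact: separated_extension.
exists (inl a), (inl b), (inl d), (inl y), (inl z).
move: ab hd yz; rewrite !inE => /andP[/andP[a1 a2] /andP[b2 b3]] /andP[d3 d1].
move=> /andP[y2 z3]; rewrite a1 a2 b2 b3 d3 d1 y2 z3; split=> //.
rewrite !card_extension.
(* A vertex of a pair enlarges its own clique when cloned and the opposite one when anticloned. *)
have grow (P Q : {set G}) u : u \in P ->
    (c u <= [exists v, extends P Q v])%N /\
    (~~ c u <= [exists v, extends Q P v])%N.
  move=> uP; case: (boolP (c u)) => cu; split=> //.
    by rewrite (@extends_ge1 _ _ u) // /extends uP cu.
  by rewrite (@extends_ge1 _ _ u) // /extends uP cu orbT.
have total (g1 h1 g2 h2 g3 h3 : nat) :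
    (4 <= g1 + h1 + (g2 + h2) + (g3 + h3))%N ->
    (n + 4 <= #|P1| + g1 + (#|Q1| + h1) + (#|P2| + g2 + (#|Q2| + h2))
              + (#|P3| + g3 + (#|Q3| + h3)))%N by lia.
apply: total.
have [ga1 ha1] := grow P1 Q1 a a1; have [hd1 gd1] := grow Q1 P1 d d1.
have [ga2 ha2] := grow P2 Q2 a a2; have [gb2 hb2] := grow P2 Q2 b b2.
have [hy2 gy2] := grow Q2 P2 y y2; have [gb3 hb3] := grow P3 Q3 b b3.
have [gd3 hd3] := grow P3 Q3 d d3; have [hz3 gz3] := grow Q3 P3 z z3.
move: {grow le_n} ga1 ha1 hd1 gd1 ga2 ha2 gb2 hb2 hy2 gy2 gb3 hb3 gd3 hd3 hz3 gz3.
by do 6!case: [exists v, _]; case: (c a) (c b) (c d) (c y) (c z) => [] [] [] [] [].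
Qed.

End Step.

(** * The graphs after three steps, by computation *)

(* [r] is the closed adjacency of a graph on the vertices [0, ..., n - 1], and
   the copy of [i] is [n + i]; it is a clone when the [i]-th entry of [s] is
   true. *)
Definition step_rel n (s : seq bool) (r : rel nat) : rel nat := fun i j =>
  match (i < n)%N, (j < n)%N with
  | true, true => r i j
  | true, false => nth false s (j - n) == r (j - n)%N i
  | false, true => nth false s (i - n) == r (i - n)%N j
  | false, false => i == j
  end.

(** Numbering vertices of an abstract graph reduces the search for a configuration in it to
    evaluating [r]. *)
Definition represents n (r : rel nat) (G : sgraph) := exists f : nat -> G,
  {in gtn n &, injective f} /\ {in gtn n &, forall i j, cadj (f i) (f j) = r i j}.

Lemma represents_step n r (G : sgraph) (c : G -> bool) :
  represents n r G ->
  exists2 s, size s = n & represents (n + n) (step_rel n s r) (step c).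
Proof.
move=> [f [f_inj fE]]; exists (mkseq (c \o f) n); first exact: size_mkseq.
exists (fun i => if (i < n)%N then inl (f i) else inr (f (i - n)%N)).
have sub i : (i < n)%N = false -> (i < n + n)%N -> (i - n < n)%N by lia.
split=> i j; rewrite !inE => hi hj.
  case: ifP => ni; case: ifP => nj // [] /f_inj; rewrite !inE => eq_ij.
    exact: eq_ij.
  by have := eq_ij (sub _ ni hi) (sub _ nj hj); lia.
rewrite /step_rel; case: ifP => ni; case: ifP => nj; rewrite cadj_step.
- exact: fE.
- by rewrite nth_mkseq ?sub //= fE ?inE ?sub.
- by rewrite nth_mkseq ?sub //= fE ?inE ?sub.
rewrite (inj_in_eq f_inj) ?inE ?sub //; apply/eqP/eqP; lia.
Qed.

Lemma represents_giso n r (G H : sgraph) :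
  giso G H -> represents n r G -> represents n r H.
Proof.
move=> [g /bij_inj g_inj gE] [f [f_inj fE]]; exists (g \o f).
split=> i j hi hj /=; last by rewrite cadj_inj ?fE.
by move/g_inj; apply: f_inj.
Qed.

Lemma represents_IIM1 k (H : sgraph) : IIM K1 k.+1 H ->
  exists2 G, IIM K1 k G & forall n r, represents n r G ->
  exists2 s, size s = n & represents (n + n) (step_rel n s r) H.
Proof.
move=> hH; inversion hH as [|k' G c H' hG iso]; subst.
exists G => // n r /(@represents_step n r _ c)[s sz rs].
by exists s => //; exact: represents_giso iso rs.
Qed.

Lemma represents_IIM3 (H : sgraph) : IIM K1 3 H -> exists s1 s2 s3,
  [/\ size s1 = 1%N, size s2 = 2%N, size s3 = 4%N & represents 8
    (step_rel 4 s3 (step_rel 2 s2 (step_rel 1 s1 (fun _ _ => true)))) H].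
Proof.
case/represents_IIM1=> G2 + r3; case/represents_IIM1=> G1 + r2.
case/represents_IIM1=> G0 h0 r1.
have r0 : represents 1 (fun _ _ => true) G0.
  inversion h0 as [G iso|]; subst; apply: represents_giso iso _.
  by exists (fun _ => tt); split=> -[|i] [|j].
have [s1 z1 /r2[s2 z2 /r3[s3 z3 rs]]] := r1 _ _ r0.
by exists s1, s2, s3.
Qed.

(** For a closed adjacency [r], this is an induced path [a], [b], [d] with a vertex [y] away from
    its first edge and a vertex [z] away from its second. *)
Definition has_seed n (r : rel nat) :=
  let vs := iota 0 n in
  has (fun a => has (fun b => r a b && has (fun d =>
    [&& r b d, ~~ r a d, has (fun y => ~~ r a y && ~~ r b y) vs
      & has (fun z => ~~ r b z && ~~ r d z) vs]) vs) vs) vs.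

(** Three steps from one vertex copy 1 + 2 + 4 vertices, which leaves 2^7 clone patterns, all
    checked by evaluation. *)
Lemma has_seed3 s1 s2 s3 : size s1 = 1%N -> size s2 = 2%N -> size s3 = 4%N ->
  has_seed 8 (step_rel 4 s3 (step_rel 2 s2 (step_rel 1 s1 (fun _ _ => true)))).
Proof.
case: s1 => [|b1 []] // _; case: s2 => [|b2 [|b3 []]] // _.
case: s3 => [|b4 [|b5 [|b6 [|b7 []]]]] // _.
by case: b1 b2 b3 b4 b5 b6 b7 => [] [] [] [] [] [] []; vm_compute.
Qed.

Lemma linked_pairs_seed n r (G : sgraph) :
  represents n r G -> has_seed n r -> linked_pairs G 8.
Proof.
move=> [f [_ fE]] /hasP[a] /[!mem_iota] an /hasP[b] /[!mem_iota] bn /andP[ab].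
move=> /hasP[d] /[!mem_iota] dn /and4P[bd ad].
move=> /hasP[y] /[!mem_iota] yn /andP[ay by_] /hasP[z] /[!mem_iota] zn.
move=> /andP[bz dz]; move: ab bd ad ay by_ bz dz; rewrite -!fE //.
move: (f a) (f b) (f d) (f y) (f z) => {an bn dn yn zn fE a b d y z} a b d y z.
move=> ab bd ad ay yb bz dz.
have sep (A B : {set G}) : {in A &, forall u v, cadj u v} ->
  {in B &, forall u v, cadj u v} -> {in A & B, forall u v, ~~ cadj u v} ->
  separated A B by [].
(* The pairs have sizes 1 + 1, 2 + 1 and 2 + 1, hence the 8; [a], [b] and [d] themselves are the
   links. *)
exists [set a], [set d], [set a; b], [set y], [set b; d], [set z].
split.
- by apply: sep => u v /set1P-> /set1P->; rewrite ?cadj_refl.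
- apply: sep => u v; rewrite !inE.
  + by move=> /orP[]/eqP-> /orP[]/eqP->; rewrite ?cadj_refl // cadj_sym.
  + by move=> /eqP-> /eqP->; rewrite cadj_refl.
  + by move=> /orP[]/eqP-> /eqP->.
- apply: sep => u v; rewrite !inE.
  + by move=> /orP[]/eqP-> /orP[]/eqP->; rewrite ?cadj_refl // cadj_sym.
  + by move=> /eqP-> /eqP->; rewrite cadj_refl.
  + by move=> /orP[]/eqP-> /eqP->.
exists a, b, d, y, z; rewrite !inE !eqxx ?orbT; split=> //.
(* Identifying [b] with [a] or with [d] would give [cadj a d]. *)
have nab : a != b by apply: contraNneq ad => ->.
have nbd : b != d by apply: contraNneq ad => <-.
by rewrite !cards2 !cards1 nab nbd.
Qed.

(** * Induction on the time steps and the final bound *)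

Lemma linked_pairs_IIM k (H : sgraph) :
  IIM K1 (k + 3) H -> linked_pairs H (4 * k + 8).
Proof.
elim: k H => [|k IH] H hH.
  have [s1 [s2 [s3 [z1 z2 z3 rs]]]] := represents_IIM3 hH.
  exact: linked_pairs_seed rs (has_seed3 z1 z2 z3).
inversion hH as [|k' G c H' hG iso]; subst.
case: iso => f /bij_inj f_inj fE.
have -> : (4 * k.+1 + 8 = 4 * k + 8 + 4)%N by lia.
exact/(linked_pairs_imset f_inj fE)/linked_pairs_step/IH.
Qed.

Theorem theorem4p7 (k : nat) (H : sgraph) (hH : IIM K1 k H) :
  2 + Num.ceil (2 * (k%:R - 5) / 3 : rat) <= (clique_number H)%:Z.
Proof.
(* An integer bounds a ceiling from above exactly when it bounds the number itself, so this is the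
   claim with denominators cleared; for [k <= 2] the constant 4 suffices. *)
have le_k : (2 * k <= 3 * clique_number H + 4)%N.
  have [k2|k3] := leqP k 2; first by lia.
  have hk : IIM K1 (k - 3 + 3) H by rewrite subnK.
  by have := linked_pairs_clique_number (linked_pairs_IIM hk); lia.
rewrite -lerBrDl ceil_le_int rmorphB /=.
have : (2 * k)%:R <= (3 * clique_number H + 4)%:R :> rat by rewrite ler_nat.
rewrite natrD !natrM -pmulrn; lra.
Qed.
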